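(* For each positive integer $n$, the number $P_n = 2^{n-1}(2^n-1)$ can be represented as a sum of four cubes of integers, i.e. there exist $a,b,c,d\in\mathbb{Z}$ with $P_n=a^3+b^3+c^3+d^3$.
   Context: The integers whose cubes are summed may be negative or zero. *)

(* Defs.v *)
From mathcomp Require Export all_boot all_order all_algebra.

(* Main.v *)
Require Import Defs.
From mathcomp Require Import all_boot all_order all_algebra.
From mathcomp Require Import ring.
Import Order.TTheory GRing.Theory Num.Theory.
Local Open Scope ring_scope.

(** Two residue classes consist of sums of four cubes by a polynomial identity:
    the multiples of 6 ([multiple_of_6_sum_four_cubes]) and the integers
    congruent to 10 modulo 18 ([mod18_eq10_sum_four_cubes]).  Every
    [P_n = 2 ^ (n - 1) * (2 ^ n - 1)] with [n > 1] lies in one of them, by the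
    parity of [n].  If [n] is even, [2 ^ (n - 1)] is even and 3 divides
    [2 ^ n - 1].  If [n > 1] is odd, [P_n = u * (2 * u - 1)] with
    [u = 2 ^ (n - 1)] a positive power of 4, so that [u] is 4 modulo 6 and [P_n]
    is 10 modulo 18.  The remaining value [P_1 = 1] is itself a cube. *)

(** The second difference of the cube at [k] is [6 * k]. *)
Lemma multiple_of_6_sum_four_cubes (k : int) :
  exists a b c d : int, 6 * k = a ^+ 3 + b ^+ 3 + c ^+ 3 + d ^+ 3.
Proof. by exists (k + 1), (k - 1), (- k), (- k); ring. Qed.

(** The four linear forms come in two pairs with opposite leading coefficients,
    so the cubic terms cancel.  The pair sums [-9] and [1] are weighted in the
    quadratic term by the squared leading coefficients [1] and [9], so the
    quadratic terms cancel too and only a linear polynomial remains. *)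
Lemma mod18_eq10_sum_four_cubes (k : int) :
  exists a b c d : int, 18 * k + 10 = a ^+ 3 + b ^+ 3 + c ^+ 3 + d ^+ 3.
Proof.
by exists (k + 6), (- k - 15), (3 * k + 33), (- (3 * k) - 32); ring.
Qed.

Lemma exp4_mod3 (m : nat) : exists s : int, 2 ^+ m.*2 = 3 * s + 1 :> int.
Proof.
elim: m => [|m [s IHs]]; first by exists 0.
by exists (4 * s + 1); rewrite doubleS !exprS IHs; ring.
Qed.

Theorem theorem2p4 (n : nat) (hn : (0 < n)%N) :
  exists a b c d : int,
    2 ^+ (n - 1)%N * (2 ^+ n - 1) = a ^+ 3 + b ^+ 3 + c ^+ 3 + d ^+ 3 :> int.
Proof.
case: n hn => // n _; rewrite subn1 /=.
have [m [b ->]] : exists m (b : bool), n = (b + m.*2)%N.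
  by exists n./2, (odd n); rewrite odd_double_half.
case: b; rewrite ?add1n ?add0n.
- have [s Hs] := exp4_mod3 m.
  have -> : 2 ^+ m.*2.+1 * (2 ^+ m.*2.+2 - 1)
            = 6 * ((3 * s + 1) * (4 * s + 1)) :> int.
    by rewrite !exprS Hs; ring.
  exact: multiple_of_6_sum_four_cubes.
case: m => [|m]; first by exists 1, 0, 0, 0.
have [s Hs] := exp4_mod3 m.
(* Here [2 ^+ m.+1.*2 = 4 * (3 * s + 1)] is the [u] of the odd case. *)
have -> : 2 ^+ m.+1.*2 * (2 ^+ m.+1.*2.+1 - 1)
          = 18 * (16 * s ^+ 2 + 10 * s + 1) + 10 :> int.
  by rewrite doubleS !exprS Hs; ring.
exact: mod18_eq10_sum_four_cubes.
Qed.
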